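(* Let $n\geq 1$ be an integer, let $f\in\mathcal{A}_n$, let $\alpha$ be a real number with $0\leq\alpha<1$, and let $\beta$ be a complex number with $\mathrm{Re}(\beta)<n$. If $$\left|zf''(z)-\beta\left(f'(z)-1\right)\right|<(1-\alpha)|n-\beta|\qquad\text{for all } z\in\mathbb{U},$$ then $$|f'(z)-1|<1-\alpha\qquad\text{for all } z\in\mathbb{U},$$ and hence $f\in\mathcal{C}(\alpha)$.
   Context: $\mathbb{U}=\{z\in\mathbb{C}:|z|<1\}$ is the open unit disk. For an integer $n\geq1$, $\mathcal{A}_n$ is the class of functions $f$ analytic in $\mathbb{U}$ with power series of the form $f(z)=z+a_{n+1}z^{n+1}+a_{n+2}z^{n+2}+\cdots$. For $0\leq\alpha<1$, $\mathcal{C}(\alpha)$ is the class of $f\in\mathcal{A}_n$ such that $\mathrm{Re}(f'(z))>\alpha$ for all $z\in\mathbb{U}$. *)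

(* Defs.v *)
(* Stdlib reals, with Coquelicot's complex numbers C. *)
From Stdlib Require Import Reals.
From Coquelicot Require Import Coquelicot.
Open Scope R_scope.

Definition unit_disk (z : C) : Prop := Cmod z < 1.

(* Functions on the disk are total functions C -> C whose values outside the
   open disk are irrelevant. [ex_derive] on C is complex differentiability. *)
Definition analytic_in_disk (f : C -> C) : Prop :=
  forall z : C, unit_disk z -> ex_derive (K := C_AbsRing) (V := C_NormedModule) f z.

Definition class_A (n : nat) (f : C -> C) : Prop :=
  analytic_in_disk f /\
  exists a : nat -> C,
    a 0%nat = RtoC 0 /\
    a 1%nat = RtoC 1 /\
    (forall k : nat, (2 <= k <= n)%nat -> a k = RtoC 0) /\
    (forall z : C, unit_disk z ->
       is_pseries (K := C_AbsRing) (V := C_NormedModule) a z (f z)).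

Definition class_C (n : nat) (alpha : R) (f : C -> C) : Prop :=
  class_A n f /\ forall z : C, unit_disk z -> Re (C_derive f z) > alpha.

(* Main.v *)
Require Import Defs.
From Stdlib Require Import Reals Lra Lia ClassicalEpsilon.
From Coquelicot Require Import Coquelicot.
Open Scope R_scope.

(** The vanishing of a_2, ..., a_n says that f'(z) - 1 = z^n Q(z) with Q analytic
    in the disk, and then
      z f''(z) - beta (f'(z) - 1) = z^n ((n - beta) Q(z) + z Q'(z)).
    Fix 0 < r < 1 and let z0 maximise |Q| over the closed disk |z| <= r, with z0 on
    its boundary, as the maximum modulus principle ([max_modulus]) permits. Moving from
    z0 into the disk cannot increase |Q|; to first order this says that
    z0 Q'(z0) conj(Q(z0)) is real and nonnegative ([boundary_max_derivative]), that is,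
    z0 Q'(z0) points in the direction of Q(z0). This is Jack's lemma. As
    Re (n - beta) > 0, adding z0 Q'(z0) to (n - beta) Q(z0) can only increase the modulus
    ([Cmod_add_same_direction]), so the hypothesis at z0 gives
      r^n |n - beta| |Q(z0)| < (1 - alpha) |n - beta|,
    and for |z| = r one gets |f'(z) - 1| = r^n |Q(z)| <= r^n |Q(z0)| < 1 - alpha.

    Two tools are built on the way. Complex power series convergent in the disk are
    differentiated term by term ([CPSeries_derive]); this makes sense of f'' and of the
    second derivative of Q. The maximum modulus principle is obtained without
    integration: for e > 0 the function |Q|^2 + e |z|^2 has no local maximum in the open
    disk, because its Laplacian is positive ([no_interior_max]); let e tend to 0. *)

(** * Complex derivatives *)

Definition is_cderive (f : C -> C) (z l : C) : Prop :=
  is_derive (K := C_AbsRing) (V := C_NormedModule) f z l.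

Lemma is_cderive_eps (f : C -> C) (z l : C) :
  is_cderive f z l <->
  forall eps : R, 0 < eps -> exists delta : R, 0 < delta /\
    forall w : C, Cmod (w - z) < delta ->
      Cmod (f w - f z - (w - z) * l)%C <= eps * Cmod (w - z).
Proof.
split.
- intros [_ H] eps Heps.
  destruct (H z (fun P HP => HP) (mkposreal eps Heps)) as [d Hd].
  exists d; split; [apply cond_pos|].
  intros w Hw. exact (Hd w Hw).
- intros H; split.
  + apply (is_linear_scal_l (K := C_AbsRing) (V := C_NormedModule) l).
  + intros x Hx.
    assert (E := is_filter_lim_locally_unique (K := C_AbsRing)
      (V := AbsRing_NormedModule C_AbsRing) z x Hx).
    subst x.
    intros eps. destruct (H eps (cond_pos eps)) as (d & Hd & HH).
    exists (mkposreal d Hd). intros w Hw. exact (HH w Hw).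
Qed.

(** The criterion met by power series, whose Taylor remainders are dominated by a
    convergent series times |h|^2. *)
Lemma is_cderive_quadratic (f : C -> C) (z l : C) (d K : R) :
  0 < d ->
  (forall h : C, Cmod h < d -> Cmod (f (z + h) - f z - h * l)%C <= K * Cmod h ^ 2) ->
  is_cderive f z l.
Proof.
intros Hd H. apply is_cderive_eps. intros eps Heps.
pose (K' := Rmax K 1).
assert (HK : K <= K' /\ 1 <= K') by (split; [apply Rmax_l | apply Rmax_r]).
exists (Rmin d (eps / K')). split.
- apply Rmin_glb_lt; [lra|]. apply Rdiv_lt_0_compat; lra.
- intros w Hw.
  assert (H1 := H (w - z)%C (Rlt_le_trans _ _ _ Hw (Rmin_l _ _))).
  replace (z + (w - z))%C with w in H1 by ring.
  eapply Rle_trans; [exact H1|].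
  assert (H2 := Rlt_le_trans _ _ _ Hw (Rmin_r _ _)).
  assert (H0 := Cmod_ge_0 (w - z)).
  assert (Cmod (w - z) * K' <= eps).
  { apply Rmult_lt_compat_r with (r := K') in H2; [|lra].
    unfold Rdiv in H2. rewrite Rmult_assoc, Rinv_l in H2; lra. }
  nra.
Qed.

(** The two normed modules on C carry different uniform structures, but the same norm,
    and differentiability sees only the norm. The general product rule is stated for
    the second one. *)
Lemma is_cderive_AbsRing (f : C -> C) (z l : C) :
  is_cderive f z l <-> is_derive (K := C_AbsRing) (V := AbsRing_NormedModule C_AbsRing) f z l.
Proof.
split; intros [_ H]; (split; [|exact H]).
- apply (is_linear_scal_l (K := C_AbsRing) (V := AbsRing_NormedModule C_AbsRing) l).
- apply (is_linear_scal_l (K := C_AbsRing) (V := C_NormedModule) l).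
Qed.

Lemma is_cderive_mult (f g : C -> C) (z l m : C) :
  is_cderive f z l -> is_cderive g z m ->
  is_cderive (fun w => f w * g w)%C z (l * g z + f z * m)%C.
Proof.
rewrite !is_cderive_AbsRing. intros Hf Hg.
exact (is_derive_mult (K := C_AbsRing) f g z l m Hf Hg Cmult_comm).
Qed.

Lemma is_cderive_const (a z : C) : is_cderive (fun _ => a) z (RtoC 0).
Proof. exact (is_derive_const (K := C_AbsRing) (V := C_NormedModule) a z). Qed.

Lemma is_cderive_pow (n : nat) (z : C) :
  is_cderive (fun w => w ^ n)%C z (RtoC (INR n) * z ^ pred n)%C.
Proof.
induction n as [|n IH].
- replace (RtoC (INR 0) * z ^ pred 0)%C with (RtoC 0) by (simpl; ring).
  apply (is_cderive_const 1%C).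
- replace (RtoC (INR (S n)) * z ^ pred (S n))%C
    with (1 * z ^ n + z * (RtoC (INR n) * z ^ pred n))%C.
  + apply (is_cderive_mult (fun w => w)); [|exact IH].
    apply is_cderive_AbsRing. exact (is_derive_id (K := C_AbsRing) z).
  + rewrite S_INR, RtoC_plus. destruct n; simpl; ring.
Qed.

Lemma is_cderive_ext_disk (f g : C -> C) (z l : C) :
  (forall w, unit_disk w -> f w = g w) -> unit_disk z ->
  is_cderive f z l -> is_cderive g z l.
Proof.
intros E Hz H. unfold unit_disk in Hz. apply is_cderive_eps. intros eps Heps.
destruct (proj1 (is_cderive_eps _ _ _) H eps Heps) as (d & Hd & Hw).
exists (Rmin d (1 - Cmod z)); split; [apply Rmin_glb_lt; lra|].
intros w Hwz.
assert (A := Rmin_l d (1 - Cmod z)). assert (B := Rmin_r d (1 - Cmod z)).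
rewrite <- !E; [apply Hw; lra | exact Hz |].
unfold unit_disk. replace w with ((w - z) + z)%C by ring.
eapply Rle_lt_trans; [apply Cmod_triangle | lra].
Qed.

(** Restricting to real lines turns statements about |f|^2 into one-variable calculus. *)
Lemma is_cderive_line (f : C -> C) (z0 l zeta : C) (t : R) :
  is_cderive f (z0 + t * zeta)%C l ->
  is_derive (fun s : R => Re (f (z0 + s * zeta)%C)) t (Re (zeta * l)%C) /\
  is_derive (fun s : R => Im (f (z0 + s * zeta)%C)) t (Im (zeta * l)%C).
Proof.
intros H.
assert (Hline : forall eps, 0 < eps -> exists d, 0 < d /\ forall s, Rabs (s - t) < d ->
  Cmod (f (z0 + s * zeta) - f (z0 + t * zeta) - RtoC (s - t) * (zeta * l))%C
    <= eps * Rabs (s - t)).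
{ intros eps Heps. assert (Hc := Cmod_ge_0 zeta).
  destruct (proj1 (is_cderive_eps _ _ _) H (eps / (1 + Cmod zeta))) as (d & Hd & Hw).
  { apply Rdiv_lt_0_compat; lra. }
  exists (d / (1 + Cmod zeta)); split; [apply Rdiv_lt_0_compat; lra|].
  intros s Hs. specialize (Hw (z0 + s * zeta)%C).
  replace (z0 + s * zeta - (z0 + t * zeta))%C with (RtoC (s - t) * zeta)%C in Hw
    by (rewrite RtoC_minus; ring).
  rewrite Cmod_mult, Cmod_R in Hw.
  replace (RtoC (s - t) * (zeta * l))%C with (RtoC (s - t) * zeta * l)%C by ring.
  assert (H0 := Rabs_pos (s - t)).
  eapply Rle_trans; [apply Hw|].
  - apply Rmult_lt_compat_r with (r := 1 + Cmod zeta) in Hs; [|lra].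
    unfold Rdiv in Hs. rewrite Rmult_assoc, Rinv_l in Hs by lra. nra.
  - apply Rmult_le_reg_r with (1 + Cmod zeta); [lra|].
    replace (eps / (1 + Cmod zeta) * (Rabs (s - t) * Cmod zeta) * (1 + Cmod zeta))
      with (eps * Rabs (s - t) * Cmod zeta) by (field; lra).
    assert (0 <= eps * Rabs (s - t)) by (apply Rmult_le_pos; lra). nra. }
assert (Hreal : forall (p : C -> R), (forall a b, p (a - b)%C = p a - p b) ->
  (forall (r : R) a, p (RtoC r * a)%C = r * p a) -> (forall a, Rabs (p a) <= Cmod a) ->
  is_derive (fun s : R => p (f (z0 + s * zeta)%C)) t (p (zeta * l)%C)).
{ intros p pm ps pn. apply is_derive_Reals. intros eps Heps.
  destruct (Hline (eps / 2)) as (d & Hd & Hs); [lra|].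
  exists (mkposreal d Hd). intros h Hh0 Hh. simpl in Hh.
  specialize (Hs (t + h)). replace (t + h - t) with h in Hs by ring.
  specialize (Hs Hh). assert (P := Rabs_pos_lt h Hh0).
  assert (Q := Rle_trans _ _ _ (pn _) Hs). rewrite !pm, ps in Q.
  match goal with |- Rabs (?a / h - ?b) < _ =>
    replace (a / h - b) with ((a - h * b) * / h) by (field; exact Hh0) end.
  rewrite Rabs_mult, Rabs_inv.
  apply Rmult_lt_reg_r with (Rabs h); [exact P|].
  rewrite Rmult_assoc, Rinv_l by lra. rewrite Rmult_1_r.
  eapply Rle_lt_trans; [exact Q|]. nra. }
split; apply Hreal.
- intros [a b] [c d]; simpl; ring.
- intros r [a b]; simpl; ring.
- apply re_le_Cmod.
- intros [a b] [c d]; simpl; ring.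
- intros r [a b]; simpl; ring.
- intros a. apply Rle_trans with (2 := Rmax_Cmod a). apply Rmax_r.
Qed.

Lemma is_cderive_continuity_2d (f : C -> C) (z l : C) :
  is_cderive f z l ->
  continuity_2d_pt (fun x y => Re (f (x, y))) (Re z) (Im z) /\
  continuity_2d_pt (fun x y => Im (f (x, y))) (Re z) (Im z).
Proof.
intros H.
assert (Hf : forall e : posreal, exists d : posreal, forall u v,
  Rabs (u - Re z) < d -> Rabs (v - Im z) < d -> Cmod (f (u, v) - f z)%C < e).
{ intros e. destruct (proj1 (is_cderive_eps _ _ _) H 1 Rlt_0_1) as (d & Hd & Hw).
  assert (Hl := Cmod_ge_0 l).
  pose (d' := Rmin (d / 2) (e / (2 * (2 + Cmod l)))).
  assert (Hd1 : d' <= d / 2) by apply Rmin_l.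
  assert (Hd2 : d' <= e / (2 * (2 + Cmod l))) by apply Rmin_r.
  assert (Hd0 : 0 < d').
  { apply Rmin_glb_lt; [lra|]. apply Rdiv_lt_0_compat; [apply cond_pos | lra]. }
  exists (mkposreal d' Hd0). intros u v Hu Hv. simpl in Hu, Hv.
  assert (Hm : Cmod ((u, v) - z)%C < 2 * d').
  { assert (H1 := Cmod2_alt ((u, v) - z)%C). assert (H0 := Cmod_ge_0 ((u, v) - z)%C).
    replace (Re ((u, v) - z)%C) with (u - Re z) in H1 by (destruct z; simpl; ring).
    replace (Im ((u, v) - z)%C) with (v - Im z) in H1 by (destruct z; simpl; ring).
    apply Rabs_def2 in Hu. apply Rabs_def2 in Hv. nra. }
  specialize (Hw (u, v) ltac:(lra)). set (m := Cmod ((u, v) - z)%C) in *.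
  replace (f (u, v) - f z)%C
    with ((f (u, v) - f z - ((u, v) - z) * l) + ((u, v) - z) * l)%C by ring.
  eapply Rle_lt_trans; [apply Cmod_triangle|]. rewrite Cmod_mult. fold m.
  assert (2 * d' * (2 + Cmod l) <= e).
  { apply Rmult_le_compat_r with (r := 2 * (2 + Cmod l)) in Hd2; [|lra].
    unfold Rdiv in Hd2. rewrite Rmult_assoc, Rinv_l in Hd2 by lra. lra. }
  assert (0 <= m) by apply Cmod_ge_0. nra. }
split; intros e; destruct (Hf e) as [d Hd]; exists d; intros u v Hu Hv;
  specialize (Hd u v Hu Hv); eapply Rle_lt_trans; try exact Hd.
- replace (Re (f (u, v)) - Re (f (Re z, Im z))) with (Re (f (u, v) - f z)%C).
  + apply re_le_Cmod.
  + destruct z; unfold Re, Im; simpl; ring.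
- replace (Im (f (u, v)) - Im (f (Re z, Im z))) with (Im (f (u, v) - f z)%C).
  + apply Rle_trans with (2 := Rmax_Cmod _). apply Rmax_r.
  + destruct z; unfold Re, Im; simpl; ring.
Qed.

(** * Power series in the unit disk *)

Lemma pow_n_Cpow (z : C) (k : nat) : pow_n (K := C_Ring) z k = (z ^ k)%C.
Proof. induction k as [|k IH]; simpl; [reflexivity | rewrite IH; reflexivity]. Qed.

Definition is_cpseries (a : nat -> C) (z l : C) : Prop :=
  is_pseries (K := C_AbsRing) (V := C_NormedModule) a z l.

Lemma is_cpseries_series (a : nat -> C) (z l : C) :
  is_cpseries a z l <->
  is_series (K := C_AbsRing) (V := C_NormedModule) (fun k => z ^ k * a k)%C l.
Proof.
unfold is_cpseries, is_pseries; split; apply is_series_ext; intros k;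
  [|symmetry]; now rewrite <- (pow_n_Cpow z k).
Qed.

Lemma is_cpseries_unique (a : nat -> C) (z l l' : C) : is_cpseries a z l -> is_cpseries a z l' -> l = l'.
Proof.
intros H H'.
exact (filterlim_locally_unique (K := C_AbsRing) (V := C_NormedModule) _ l l' H H').
Qed.

Definition CPSeries (a : nat -> C) (z : C) : C :=
  iota (T := C_CompleteNormedModule) (is_cpseries a z).

Lemma CPSeries_unique (a : nat -> C) (z l : C) : is_cpseries a z l -> CPSeries a z = l.
Proof.
intros H.
apply (iota_unique (V := C_CompleteNormedModule) (is_cpseries a z)); [|exact H].
intros y Hy. now apply (is_cpseries_unique a z).
Qed.

Lemma CPSeries_correct (a : nat -> C) (z : C) :
  (exists l, is_cpseries a z l) -> is_cpseries a z (CPSeries a z).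
Proof. intros [l H]. now rewrite (CPSeries_unique a z l H). Qed.

(** Triangle inequality for infinite sums. *)
Lemma cseries_norm_le (u : nat -> C) (v : nat -> R) (l : C) (s : R) :
  is_series (K := C_AbsRing) (V := C_NormedModule) u l ->
  is_series v s -> (forall k, Cmod (u k) <= v k) -> Cmod l <= s.
Proof.
intros Hu Hv H.
apply (filterlim_le (F := eventually) (fun n => Cmod (sum_n (G := C_AbelianMonoid) u n)) (sum_n v) (Cmod l) s).
- exists 0%nat; intros n _.
  apply Rle_trans with (sum_n (fun k => Cmod (u k)) n).
  + apply (norm_sum_n_m (K := C_AbsRing) (V := C_NormedModule) u 0 n).
  + now apply sum_n_m_le.
- apply (filterlim_comp _ _ _ _ _ _ _ _ Hu).
  apply (filterlim_norm (K := C_AbsRing) (V := C_NormedModule)).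
- exact Hv.
Qed.

Lemma is_cpseries_terms_bounded (a : nat -> C) (z l : C) :
  is_cpseries a z l -> exists B, 0 < B /\ forall k, Cmod (a k) * Cmod z ^ k <= B.
Proof.
intros H. apply is_cpseries_series in H.
destruct (filterlim_bounded (K := C_AbsRing) (V := C_NormedModule)
  (sum_n (G := C_AbelianMonoid) (fun k => z ^ k * a k)%C)) as [M HM].
{ exists l. exact H. }
assert (HM' : forall n, Cmod (sum_n (G := C_AbelianMonoid) (fun k => z ^ k * a k)%C n) <= M)
  by exact HM.
assert (M0 : 0 <= M) by (eapply Rle_trans; [apply Cmod_ge_0 | apply (HM' 0%nat)]).
exists (2 * M + 1). split; [lra|]. intros k.
rewrite <- Cmod_pow, Rmult_comm, <- Cmod_mult.
destruct k as [|k].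
- specialize (HM' 0%nat). rewrite sum_O in HM'. lra.
- assert (H1 := HM' (S k)). assert (H0 := HM' k).
  rewrite sum_Sn in H1. change plus with Cplus in H1.
  set (s := sum_n _ k) in *. set (t := (z ^ S k * a (S k))%C) in *.
  replace t with ((s + t) + - s)%C by (unfold s; ring).
  eapply Rle_trans; [apply Cmod_triangle|]. rewrite Cmod_opp. lra.
Qed.

Definition CPS_derive (a : nat -> C) (k : nat) : C := (RtoC (INR (S k)) * a (S k))%C.

Lemma geometric_CV_radius : CV_radius (fun _ => 1) = 1.
Proof.
rewrite (CV_radius_finite_DAlembert (fun _ => 1) 1); [now rewrite Rinv_1 | | lra |].
- intros _; exact R1_neq_R0.
- apply is_lim_seq_ext with (fun _ => 1); [|apply is_lim_seq_const].
  intros _. now rewrite Rdiv_1_r, Rabs_R1.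
Qed.

(** This series is dominated by the second derivative of the geometric series. *)
Lemma ex_series_sqr_geometric (x : R) :
  0 <= x < 1 -> ex_series (fun k => INR (S k) ^ 2 * x ^ k).
Proof.
intros Hx.
assert (R : CV_radius (PS_derive (PS_derive (fun _ => 1))) = 1)
  by now rewrite !CV_radius_derive, geometric_CV_radius.
assert (H := CV_radius_inside (PS_derive (PS_derive (fun _ => 1))) x).
rewrite R in H. rewrite ex_pseries_R in H.
assert (H1 : ex_series (fun n => PS_derive (PS_derive (fun _ => 1)) n * x ^ n)).
{ apply H. simpl. rewrite Rabs_pos_eq; lra. }
apply (ex_series_le (V := R_CompleteNormedModule)) with (2 := H1).
intros n. apply Rle_trans with (INR (S n) ^ 2 * x ^ n).
- apply Req_le, Rabs_pos_eq.
  apply Rmult_le_pos; [apply pow2_ge_0 | apply pow_le; lra].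
- apply Rmult_le_compat_r; [apply pow_le; lra|].
  unfold PS_derive. rewrite (S_INR (S n)), Rmult_1_r.
  assert (0 <= INR (S n)) by apply pos_INR. nra.
Qed.

(** Both bounds go by a joint induction on k, through
    R_{k+1} = z R_k + h ((z+h)^k - z^k) for the remainder R_k. The factors s and s^2 on
    the left stand for the division of s^k by s and s^2, which would need the exponents
    k-1 and k-2. *)
Lemma Cpow_remainder (z h : C) (s : R) (k : nat) :
  Cmod z <= s -> Cmod (z + h) <= s ->
  s * Cmod ((z + h) ^ k - z ^ k)%C <= INR k * Cmod h * s ^ k /\
  s ^ 2 * Cmod ((z + h) ^ k - z ^ k - h * (RtoC (INR k) * z ^ pred k))%C
    <= INR k ^ 2 * Cmod h ^ 2 * s ^ k.
Proof.
intros Hz Hzh.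
assert (Hs : 0 <= s) by (eapply Rle_trans; [apply Cmod_ge_0 | exact Hz]).
assert (Hh := Cmod_ge_0 h).
induction k as [|k [IH1 IH2]].
- simpl.
  replace (1 - 1)%C with (RtoC 0) by ring.
  replace (0 - h * (0 * 1))%C with (RtoC 0) by ring.
  rewrite Cmod_0. split; nra.
- assert (Hp : 0 <= s ^ k) by now apply pow_le.
  assert (Hzk : Cmod (z ^ k)%C <= s ^ k)
    by (rewrite Cmod_pow; apply pow_incr; split; [apply Cmod_ge_0 | exact Hz]).
  assert (HzS : (RtoC (INR (S k)) * z ^ k = z ^ k + z * (RtoC (INR k) * z ^ pred k))%C).
  { rewrite S_INR, RtoC_plus. destruct k as [|k]; simpl Nat.pred; [simpl; ring|].
    simpl Cpow. ring. }
  split.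
  + replace ((z + h) ^ S k - z ^ S k)%C
      with ((z + h) * ((z + h) ^ k - z ^ k) + h * z ^ k)%C by (simpl; ring).
    apply Rle_trans with (s * (s * Cmod ((z + h) ^ k - z ^ k)%C + Cmod h * s ^ k)).
    * apply Rmult_le_compat_l; [exact Hs|].
      eapply Rle_trans; [apply Cmod_triangle|]. rewrite !Cmod_mult.
      apply Rplus_le_compat.
      -- apply Rmult_le_compat_r; [apply Cmod_ge_0 | exact Hzh].
      -- now apply Rmult_le_compat_l.
    * rewrite S_INR. simpl pow.
      apply Rmult_le_compat_l with (r := s) in IH1; [|exact Hs]. lra.
  + simpl Nat.pred. rewrite HzS.
    replace ((z + h) ^ S k - z ^ S k - h * (z ^ k + z * (RtoC (INR k) * z ^ pred k)))%C
      with (z * ((z + h) ^ k - z ^ k - h * (RtoC (INR k) * z ^ pred k))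
            + h * ((z + h) ^ k - z ^ k))%C by (simpl; ring).
    set (E := Cmod ((z + h) ^ k - z ^ k - h * (RtoC (INR k) * z ^ pred k))%C) in *.
    set (D := Cmod ((z + h) ^ k - z ^ k)%C) in *.
    assert (E0 : 0 <= E) by apply Cmod_ge_0.
    assert (K0 : 0 <= INR k) by apply pos_INR.
    apply Rle_trans with (s ^ 2 * (s * E + Cmod h * D)).
    * apply Rmult_le_compat_l; [apply pow2_ge_0|].
      eapply Rle_trans; [apply Cmod_triangle|]. rewrite !Cmod_mult.
      fold E D. apply Rplus_le_compat_r. now apply Rmult_le_compat_r.
    * rewrite S_INR.
      apply Rmult_le_compat_l with (r := s) in IH2; [|exact Hs].
      apply Rmult_le_compat_l with (r := s * Cmod h) in IH1; [|nra].
      assert (0 <= Cmod h ^ 2 * s ^ S k * (INR k + 1)).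
      { apply Rmult_le_pos; [|lra]. apply Rmult_le_pos; [nra | now apply pow_le]. }
      simpl pow in *. nra.
Qed.
(** In this form the derived series is indexed like the original one, so the two can
    be subtracted termwise. *)
Lemma is_cpseries_derive_pred (a : nat -> C) (z l : C) :
  is_cpseries (CPS_derive a) z l <->
  is_series (K := C_AbsRing) (V := C_NormedModule)
    (fun k => RtoC (INR k) * z ^ pred k * a k)%C l.
Proof.
rewrite is_cpseries_series.
assert (E : forall k : nat, (z ^ k * CPS_derive a k)%C
  = (RtoC (INR (S k)) * z ^ pred (S k) * a (S k))%C)
  by (intros k; unfold CPS_derive; simpl Nat.pred; ring).
split; intros H.
- apply (is_series_decr_1 (K := C_AbsRing) (V := C_NormedModule)).
  replace (plus l _) with l.
  + exact (is_series_ext _ _ _ E H).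
  + change (l = l + - (RtoC 0 * 1 * a 0%nat))%C. ring.
- apply is_series_ext with (1 := fun k => eq_sym (E k)).
  apply (is_series_incr_1 (K := C_AbsRing) (V := C_NormedModule)
    (fun k => RtoC (INR k) * z ^ pred k * a k)%C).
  replace (plus l _) with l; [exact H|].
  change (l = l + (RtoC 0 * 1 * a 0%nat))%C. ring.
Qed.

Lemma coefficients_le (a : nat -> C) (rho : R) :
  0 < rho -> (exists l, is_cpseries a (RtoC rho) l) ->
  exists B, 0 < B /\ forall k, Cmod (a k) * rho ^ k <= B.
Proof.
intros Hr [l Hl]. destruct (is_cpseries_terms_bounded a _ _ Hl) as (B & HB & H).
exists B; split; [exact HB|]. intros k. specialize (H k).
now rewrite Cmod_R, Rabs_pos_eq in H by lra.
Qed.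

Lemma coefficient_term_le (a : nat -> C) (B rho s : R) (k : nat) :
  0 < rho -> 0 <= s -> Cmod (a k) * rho ^ k <= B ->
  Cmod (a k) * s ^ k <= B * (s / rho) ^ k.
Proof.
intros Hr Hs H.
assert (Hp : 0 < rho ^ k) by now apply pow_lt.
replace (s ^ k) with (rho ^ k * (s / rho) ^ k).
- rewrite <- Rmult_assoc. apply Rmult_le_compat_r; [|exact H].
  apply pow_le. apply Rdiv_le_0_compat; lra.
- rewrite <- Rpow_mult_distr. f_equal. field. lra.
Qed.

(** Choose |z| < s < rho < 1. Convergence at rho gives |a_k| <= B / rho^k, so that
    the derived series and the sum of the Taylor remainders of a_k z^k are dominated by
    multiples of the sum of (k+1)^2 (s / rho)^k. *)
Lemma CPSeries_derive (a : nat -> C) :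
  (forall z, unit_disk z -> exists l, is_cpseries a z l) ->
  forall z, unit_disk z ->
    (exists l, is_cpseries (CPS_derive a) z l) /\
    is_cderive (CPSeries a) z (CPSeries (CPS_derive a) z).
Proof.
intros Ha z Hz. unfold unit_disk in Hz.
assert (Hz0 := Cmod_ge_0 z).
pose (s := (1 + 2 * Cmod z) / 3). pose (rho := (2 + Cmod z) / 3).
assert (Hs : 0 < s /\ Cmod z < s /\ s < rho /\ rho < 1) by (unfold s, rho; lra).
destruct Hs as (Hs0 & Hzs & Hsr & Hr1).
assert (Hrho : 0 < rho) by lra.
destruct (coefficients_le a rho Hrho) as (B & HB & HaB).
{ apply Ha. unfold unit_disk. rewrite Cmod_R, Rabs_pos_eq; lra. }
set (x := s / rho).
assert (Hx : 0 <= x < 1).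
{ unfold x; split; [apply Rdiv_le_0_compat; lra|].
  apply Rmult_lt_reg_r with rho; [lra|]. unfold Rdiv. rewrite Rmult_assoc, Rinv_l; lra. }
destruct (ex_series_sqr_geometric x Hx) as [S0 HS0].
assert (Hterm : forall k, Cmod (a k) * s ^ k <= B * x ^ k)
  by (intros k; apply coefficient_term_le; [lra | lra | apply HaB]).
assert (Hex : exists l, is_cpseries (CPS_derive a) z l).
{ destruct (ex_series_le (K := C_AbsRing) (V := C_CompleteNormedModule)
    (fun k => z ^ k * CPS_derive a k)%C
    (fun k => (B / s * x) * (INR (S k) ^ 2 * x ^ k))) as [l Hl].
  - intros k. change norm with Cmod. unfold CPS_derive.
    rewrite !Cmod_mult, Cmod_pow, Cmod_R, (Rabs_pos_eq (INR (S k))) by apply pos_INR.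
    specialize (Hterm (S k)). set (m := INR (S k)).
    assert (Hm : 1 <= m) by (unfold m; rewrite S_INR; assert (H := pos_INR k); lra).
    apply Rle_trans with (m * (s ^ k * Cmod (a (S k)))).
    + rewrite (Rmult_comm _ (m * _)), Rmult_assoc, (Rmult_comm (Cmod (a _))).
      apply Rmult_le_compat_l; [lra|]. apply Rmult_le_compat_r; [apply Cmod_ge_0|].
      apply pow_incr; lra.
    + replace (B / s * x * (m ^ 2 * x ^ k)) with (m ^ 2 * (B * x ^ S k / s))
        by (simpl; field; lra).
      assert (H1 : s ^ k * Cmod (a (S k)) <= B * x ^ S k / s).
      { apply Rmult_le_reg_r with s; [lra|].
        replace (B * x ^ S k / s * s) with (B * x ^ S k) by (field; lra).
        simpl (s ^ S k) in Hterm. lra. }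
      assert (H2 : 0 <= s ^ k * Cmod (a (S k)))
        by (apply Rmult_le_pos; [apply pow_le; lra | apply Cmod_ge_0]).
      apply Rle_trans with (m * (B * x ^ S k / s)).
      * apply Rmult_le_compat_l; lra.
      * apply Rmult_le_compat_r; nra.
  - exists (scal (B / s * x) S0).
    exact (is_series_scal (V := R_NormedModule) _ _ _ HS0).
  - exists l. now apply is_cpseries_series. }
split; [exact Hex|].
apply (is_cderive_quadratic _ _ _ (s - Cmod z) (B / s ^ 2 * S0)); [lra|].
intros h Hh.
assert (Hzh : Cmod (z + h) <= s) by (eapply Rle_trans; [apply Cmod_triangle|]; lra).
assert (H1 := CPSeries_correct _ _ (Ha (z + h)%C ltac:(unfold unit_disk; lra))).
assert (H2 := CPSeries_correct _ _ (Ha z Hz)).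
assert (H3 := CPSeries_correct _ _ Hex).
apply is_cpseries_series in H1. apply is_cpseries_series in H2. apply is_cpseries_derive_pred in H3.
set (L1 := CPSeries a (z + h)%C) in *. set (L2 := CPSeries a z) in *.
set (L3 := CPSeries (CPS_derive a) z) in *.
assert (H4 := is_series_scal (K := C_AbsRing) (V := C_NormedModule) h _ _ H3).
assert (H5 := is_series_minus _ _ _ _ (is_series_minus _ _ _ _ H1 H2) H4).
replace (B / s ^ 2 * S0 * Cmod h ^ 2) with ((B / s ^ 2 * Cmod h ^ 2) * S0) by ring.
apply (cseries_norm_le _ (fun k => (B / s ^ 2 * Cmod h ^ 2) * (INR (S k) ^ 2 * x ^ k)) _ _ H5).
- exact (is_series_scal (V := R_NormedModule) (B / s ^ 2 * Cmod h ^ 2) _ _ HS0).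
- intros k.
  destruct (Cpow_remainder z h s k) as [_ HE]; [lra | exact Hzh |].
  set (E := ((z + h) ^ k - z ^ k - h * (RtoC (INR k) * z ^ pred k))%C) in *.
  match goal with |- Cmod ?t <= _ => replace t with (E * a k)%C end.
  2:{ change ((E * a k) = ((z + h) ^ k * a k - z ^ k * a k)
        - h * (RtoC (INR k) * z ^ pred k * a k))%C. unfold E. ring. }
  rewrite Cmod_mult.
  assert (Hs2 : 0 < s ^ 2) by now apply pow_lt.
  assert (A0 := Cmod_ge_0 (a k)).
  apply Rmult_le_reg_l with (s ^ 2); [exact Hs2|].
  replace (s ^ 2 * (B / s ^ 2 * Cmod h ^ 2 * (INR (S k) ^ 2 * x ^ k)))
    with (INR (S k) ^ 2 * Cmod h ^ 2 * (B * x ^ k)) by (field; lra).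
  apply Rle_trans with (INR k ^ 2 * Cmod h ^ 2 * (Cmod (a k) * s ^ k)).
  + apply Rmult_le_compat_r with (r := Cmod (a k)) in HE; [|exact A0]. lra.
  + specialize (Hterm k).
    assert (0 <= Cmod (a k) * s ^ k) by (apply Rmult_le_pos; [lra | apply pow_le; lra]).
    assert (0 <= Cmod h ^ 2) by apply pow2_ge_0.
    apply Rmult_le_compat; [nra | lra | | exact Hterm].
    apply Rmult_le_compat_r; [lra|].
    rewrite S_INR. assert (Hk := pos_INR k). nra.
Qed.

(** Divide l - c_0 by z^n. At z = 0 the quotient is not determined by this equation,
    but both sides vanish there. *)
Lemma CPSeries_factor (c : nat -> C) (n : nat) (z l : C) :
  (1 <= n)%nat -> (forall k, (1 <= k < n)%nat -> c k = RtoC 0) ->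
  is_cpseries c z l ->
  is_cpseries (fun k => c (n + k)%nat) z (CPSeries (fun k => c (n + k)%nat) z) /\
  (l - c 0%nat = z ^ n * CPSeries (fun k => c (n + k)%nat) z)%C.
Proof.
intros Hn Hc Hl.
assert (Hsum : forall m, (m < n)%nat ->
  sum_n (G := C_AbelianMonoid) (fun k => scal (V := C_NormedModule) (pow_n (K := C_AbsRing) z k) (c k)) m = c 0%nat).
{ induction m as [|m IH]; intros Hm.
  - rewrite sum_O. change (1 * c 0%nat = c 0%nat)%C. ring.
  - rewrite sum_Sn, IH by lia. rewrite (Hc (S m)) by lia.
    change (c 0%nat + pow_n (K := C_Ring) z (S m) * RtoC 0 = c 0%nat)%C. ring. }
destruct (Ceq_dec z (RtoC 0)) as [->|Hz].
- split.
  + apply CPSeries_correct. eexists. apply (is_pseries_0 (K := C_AbsRing) (V := C_NormedModule)).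
  + rewrite (is_cpseries_unique c (RtoC 0) l (c 0%nat) Hl
      (is_pseries_0 (K := C_AbsRing) (V := C_NormedModule) c)).
    destruct n as [|n]; [lia|]. simpl. ring.
- assert (D := is_pseries_decr_n (K := C_AbsRing) (V := C_NormedModule) c n z (/ z)%C l
    (Cinv_l z Hz) Hn Hl).
  rewrite Hsum in D by lia.
  change (is_cpseries (fun k => c (n + k)%nat) z
    (pow_n (K := C_Ring) (/ z)%C n * (l - c 0%nat))%C) in D.
  rewrite pow_n_Cpow in D. rewrite (CPSeries_unique _ _ _ D). split; [exact D|].
  rewrite Cmult_assoc, <- Cpow_mult_l, Cinv_r by exact Hz.
  rewrite Cpow_1_l. ring.
Qed.

(** * Maxima on rectangles, disks and circles *)

(** Maximise in y for each fixed x; by uniform continuity the value of this maximum is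
    continuous in x, so it can be maximised in turn. *)
Lemma rectangle_max (F : R -> R -> R) (a b c d : R) :
  a <= b -> c <= d ->
  (forall x y, a <= x <= b -> c <= y <= d -> continuity_2d_pt F x y) ->
  exists x0 y0, a <= x0 <= b /\ c <= y0 <= d /\
    forall x y, a <= x <= b -> c <= y <= d -> F x y <= F x0 y0.
Proof.
intros Hab Hcd HF.
(* Clamping to [a,b] makes the partial maximum a function on all of R, continuous from
   both sides even at a and b. *)
pose (cl x := Rmax a (Rmin b x)).
assert (Hcl : forall x, a <= cl x <= b).
{ intros x; unfold cl; split; [apply Rmax_l|].
  apply Rmax_lub; [exact Hab | apply Rmin_l]. }
assert (Hclid : forall x, a <= x <= b -> cl x = x).
{ intros x Hx; unfold cl. rewrite Rmin_right by lra. now rewrite Rmax_right by lra. }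
assert (Hcll : forall x y, Rabs (cl x - cl y) <= Rabs (x - y)).
{ intros x y. unfold cl, Rmin.
  destruct (Rle_dec b x), (Rle_dec b y); unfold Rmax;
    repeat match goal with |- context [Rle_dec ?u ?v] => destruct (Rle_dec u v) end;
    apply Rabs_le_between'; split_Rabs; lra. }
assert (Hy : forall x, exists y, c <= y <= d /\ forall y', c <= y' <= d -> F (cl x) y' <= F (cl x) y).
{ intros x.
  destruct (continuity_ab_maj (F (cl x)) c d Hcd) as (y & H1 & H2).
  - intros y Hy e He.
    destruct (HF (cl x) y (Hcl x) Hy (mkposreal e He)) as [dl Hdl].
    exists dl; split; [apply cond_pos|].
    intros y' [_ Hy']. apply Hdl; [|exact Hy'].
    rewrite Rminus_diag, Rabs_R0. apply cond_pos.
  - exists y; split; assumption. }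
pose (Y x := proj1_sig (constructive_indefinite_description _ (Hy x))).
assert (HY : forall x, c <= Y x <= d /\ forall y, c <= y <= d -> F (cl x) y <= F (cl x) (Y x)).
{ intros x. unfold Y. exact (proj2_sig (constructive_indefinite_description _ (Hy x))). }
destruct (continuity_ab_maj (fun x => F (cl x) (Y x)) a b Hab) as (x0 & H1 & H2).
- intros x _ e He.
  destruct (uniform_continuity_2d F a b c d HF (mkposreal e He)) as [dl Hdl].
  exists dl; split; [apply cond_pos|].
  intros x' [_ Hx']. simpl in *. unfold Rdist in *.
  assert (Hd0 : forall t, Rabs (t - t) < dl)
    by (intros t; rewrite Rminus_diag, Rabs_R0; apply cond_pos).
  assert (Hc := Rle_lt_trans _ _ _ (Hcll x' x) Hx').
  destruct (HY x) as [Hc1 Hm1]. destruct (HY x') as [Hc2 Hm2].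
  assert (A := Hdl _ _ _ _ (Hcl x) Hc1 (Hcl x') Hc1 Hc (Hd0 _)).
  assert (A' := Hdl _ _ _ _ (Hcl x) Hc2 (Hcl x') Hc2 Hc (Hd0 _)).
  specialize (Hm1 _ Hc2). specialize (Hm2 _ Hc1).
  apply Rabs_def2 in A. apply Rabs_def2 in A'. apply Rabs_def1; lra.
- exists x0, (Y x0). destruct (HY x0) as [Hc0 _].
  split; [exact H2|split; [exact Hc0|]].
  intros x y Hx Hyy. destruct (HY x) as [_ Hm].
  specialize (H1 x Hx). specialize (Hm y Hyy). cbv beta in H1.
  rewrite !Hclid in H1 by assumption. rewrite !Hclid in Hm by assumption. lra.
Qed.

Lemma continuity_2d_pt_comp (f g h : R -> R -> R) (x y : R) :
  continuity_2d_pt f (g x y) (h x y) ->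
  continuity_2d_pt g x y -> continuity_2d_pt h x y ->
  continuity_2d_pt (fun x y => f (g x y) (h x y)) x y.
Proof.
intros Hf Hg Hh e. destruct (Hf e) as [d Hd].
destruct (Hg d) as [d1 H1]. destruct (Hh d) as [d2 H2].
exists (mkposreal _ (Rmin_stable_in_posreal d1 d2)). intros u v Hu Hv. simpl in Hu, Hv.
assert (Hl := Rmin_l d1 d2). assert (Hr := Rmin_r d1 d2).
apply Hd; [apply H1 | apply H2]; lra.
Qed.

(** The map (x, y) |-> (r x, r y sqrt (1 - x^2)) sends the square [-1,1]^2 onto the
    closed disk of radius r, and its two edges y = 1 and y = -1 onto the circle. This
    reduces maxima on disks and circles to maxima on rectangles without polar
    coordinates. *)
Lemma disk_param_mod (r x y : R) :
  0 < r -> -1 <= x <= 1 -> -1 <= y <= 1 ->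
  Cmod (r * x, r * (y * sqrt (1 - x ^ 2))) <= r.
Proof.
intros Hr Hx Hy. unfold Cmod; cbv [fst snd].
rewrite <- (sqrt_pow2 r) at 3 by lra. apply sqrt_le_1_alt.
assert (Ht : sqrt (1 - x ^ 2) * sqrt (1 - x ^ 2) = 1 - x ^ 2) by (apply sqrt_def; nra).
set (t := sqrt (1 - x ^ 2)) in *.
replace ((r * x) ^ 2 + (r * (y * t)) ^ 2) with (r ^ 2 * (x ^ 2 + y ^ 2 * (t * t))) by ring.
rewrite Ht.
assert (x ^ 2 <= 1) by nra. assert (y ^ 2 <= 1) by nra.
assert (x ^ 2 + y ^ 2 * (1 - x ^ 2) <= 1) by nra.
assert (0 <= r ^ 2) by apply pow2_ge_0. nra.
Qed.

Lemma disk_param_continuity (u : C -> R) (r : R) :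
  0 < r ->
  (forall z, Cmod z <= r -> continuity_2d_pt (fun x y => u (x, y)) (Re z) (Im z)) ->
  forall x y, -1 <= x <= 1 -> -1 <= y <= 1 ->
    continuity_2d_pt (fun x y => u (r * x, r * (y * sqrt (1 - x ^ 2)))) x y.
Proof.
intros Hr Hu x y Hx Hy.
apply (continuity_2d_pt_comp (fun x y => u (x, y))).
- apply (Hu (r * x, r * (y * sqrt (1 - x ^ 2)))).
  apply disk_param_mod; assumption.
- apply continuity_2d_pt_mult; [apply continuity_2d_pt_const | apply continuity_2d_pt_id1].
- apply continuity_2d_pt_mult; [apply continuity_2d_pt_const |].
  apply continuity_2d_pt_mult; [apply continuity_2d_pt_id2 |].
  apply continuity_1d_2d_pt_comp.
  + apply continuity_pt_sqrt. nra.
  + apply continuity_2d_pt_minus; [apply continuity_2d_pt_const |]. simpl.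
    repeat apply continuity_2d_pt_mult;
      (apply continuity_2d_pt_id1 || apply continuity_2d_pt_const).
Qed.

Lemma disk_param_onto (r : R) (z : C) :
  0 < r -> Cmod z <= r ->
  exists x y, -1 <= x <= 1 /\ -1 <= y <= 1 /\ z = (r * x, r * (y * sqrt (1 - x ^ 2))) /\
    (Cmod z = r -> z = (r * x, r * (1 * sqrt (1 - x ^ 2))) \/
                   z = (r * x, r * (-1 * sqrt (1 - x ^ 2)))).
Proof.
intros Hr Hz. destruct z as [p q].
assert (H2 := Cmod2_alt (p, q)). simpl Re in H2. simpl Im in H2.
assert (H0 := Cmod_ge_0 (p, q)). set (m := Cmod (p, q)) in *.
pose (x := p / r). assert (Hx : r * x = p) by (unfold x; field; lra).
pose (y := q / r). assert (Hy : r * y = q) by (unfold y; field; lra).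
rewrite <- Hx, <- Hy in H2 |- *.
assert (Hxy : x ^ 2 + y ^ 2 <= 1).
{ apply Rmult_le_reg_l with (r ^ 2); [nra|]. nra. }
assert (Hx1 : -1 <= x <= 1) by nra.
set (t := sqrt (1 - x ^ 2)).
assert (Ht0 : 0 <= t) by apply sqrt_pos.
assert (Ht : t * t = 1 - x ^ 2) by (apply sqrt_def; nra).
destruct (Req_dec t 0) as [E|E].
- exists x, 1. fold t. rewrite E in Ht |- *. assert (y = 0) by nra. subst y.
  repeat split; try lra; [f_equal; nra|]. intros _. left. f_equal. nra.
- exists x, (y / t). fold t. assert (0 < t) by lra.
  assert (Hyt : y / t * t = y) by (field; exact E).
  repeat split; try lra.
  + apply Rmult_le_reg_r with t; nra.
  + apply Rmult_le_reg_r with t; nra.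
  + now rewrite Hyt.
  + intros Em. assert (Hyy : y * y = t * t).
    { apply Rmult_eq_reg_l with (r ^ 2); [|nra]. nra. }
    destruct (Rmult_integral (y - t) (y + t)) as [K|K]; [lra | left | right]; f_equal; nra.
Qed.

Lemma disk_max (u : C -> R) (r : R) :
  0 < r ->
  (forall z, Cmod z <= r -> continuity_2d_pt (fun x y => u (x, y)) (Re z) (Im z)) ->
  exists z0, Cmod z0 <= r /\ forall z, Cmod z <= r -> u z <= u z0.
Proof.
intros Hr Hu.
destruct (rectangle_max _ (-1) 1 (-1) 1 ltac:(lra) ltac:(lra)
  (disk_param_continuity u r Hr Hu)) as (x0 & y0 & Hx & Hy & H).
exists (r * x0, r * (y0 * sqrt (1 - x0 ^ 2))).
split; [now apply disk_param_mod|].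
intros z Hz. destruct (disk_param_onto r z Hr Hz) as (x & y & Hx' & Hy' & -> & _).
now apply H.
Qed.

Lemma circle_max (u : C -> R) (r : R) :
  0 < r ->
  (forall z, Cmod z <= r -> continuity_2d_pt (fun x y => u (x, y)) (Re z) (Im z)) ->
  exists z0, Cmod z0 = r /\ forall z, Cmod z = r -> u z <= u z0.
Proof.
intros Hr Hu.
(* On each half circle only x varies, so a degenerate rectangle serves. *)
assert (Hsemi : forall e, e ^ 2 = 1 -> exists x0, -1 <= x0 <= 1 /\
  forall x, -1 <= x <= 1 ->
    u (r * x, r * (e * sqrt (1 - x ^ 2))) <= u (r * x0, r * (e * sqrt (1 - x0 ^ 2)))).
{ intros e He.
  destruct (rectangle_max (fun x _ => u (r * x, r * (e * sqrt (1 - x ^ 2)))) (-1) 1 0 0)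
    as (x0 & y0 & Hx & _ & H); [lra | lra | |].
  - intros x y Hx _.
    apply (continuity_2d_pt_comp (fun x y => u (r * x, r * (y * sqrt (1 - x ^ 2))))).
    + apply disk_param_continuity; trivial. nra.
    + apply continuity_2d_pt_id1.
    + apply continuity_2d_pt_const.
  - exists x0; split; [exact Hx|]. intros x Hx'. apply (H x 0 Hx'). lra. }
assert (Hmod : forall e x, e ^ 2 = 1 -> -1 <= x <= 1 ->
  Cmod (r * x, r * (e * sqrt (1 - x ^ 2))) = r).
{ intros e x He Hx. unfold Cmod; cbv [fst snd].
  rewrite <- (sqrt_pow2 r) at 3 by lra. f_equal.
  assert (Ht : sqrt (1 - x ^ 2) * sqrt (1 - x ^ 2) = 1 - x ^ 2) by (apply sqrt_def; nra).
  set (t := sqrt (1 - x ^ 2)) in *.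
  transitivity (r ^ 2 * (x ^ 2 + e ^ 2 * (t * t))); [ring|]. rewrite He, Ht. ring. }
destruct (Hsemi 1 ltac:(lra)) as (x1 & Hx1 & H1).
destruct (Hsemi (-1) ltac:(lra)) as (x2 & Hx2 & H2).
set (z1 := (r * x1, r * (1 * sqrt (1 - x1 ^ 2)))) in *.
set (z2 := (r * x2, r * (-1 * sqrt (1 - x2 ^ 2)))) in *.
assert (Hz1 : Cmod z1 = r) by (apply Hmod; lra).
assert (Hz2 : Cmod z2 = r) by (apply Hmod; lra).
destruct (Rle_dec (u z1) (u z2)) as [E|E]; [exists z2 | exists z1]; split; trivial;
  intros z Hz; destruct (disk_param_onto r z Hr (Req_le _ _ Hz)) as (x & y & Hx & _ & _ & Hc);
  destruct (Hc Hz) as [-> | ->]; [specialize (H1 x Hx) | specialize (H2 x Hx)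
  | specialize (H1 x Hx) | specialize (H2 x Hx)]; lra.
Qed.

(** * Maximum modulus principle and Jack's lemma *)

Lemma second_derivative_test (phi phi1 : R -> R) (d0 d : R) :
  0 < d0 ->
  (forall t, Rabs t < d0 -> is_derive phi t (phi1 t)) ->
  is_derive phi1 0 d ->
  (forall t, Rabs t < d0 -> phi t <= phi 0) ->
  d <= 0.
Proof.
intros Hd0 H1 H2 Hmax.
destruct (Rle_or_lt d 0) as [|Hd]; [assumption|exfalso].
assert (Z : phi1 0 = 0).
{ destruct (Req_dec (phi1 0) 0) as [|E]; [assumption|exfalso].
  assert (D : derivable_pt_lim phi 0 (phi1 0))
    by (apply is_derive_Reals, H1; rewrite Rabs_R0; exact Hd0).
  destruct (D (Rabs (phi1 0) / 2)) as [dl Hdl].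
  { assert (K := Rabs_pos_lt _ E). lra. }
  pose (h := Rmin (dl / 2) (d0 / 2)).
  assert (Hh : 0 < h) by (apply Rmin_glb_lt; [assert (K := cond_pos dl)|]; lra).
  assert (Hh1 : h <= dl / 2) by apply Rmin_l. assert (Hh2 : h <= d0 / 2) by apply Rmin_r.
  assert (K := cond_pos dl).
  assert (A : Rabs h < dl) by (rewrite Rabs_pos_eq; lra).
  assert (A' : Rabs (- h) < dl) by (rewrite Rabs_Ropp; exact A).
  assert (B := Hdl h ltac:(lra) A). assert (B' := Hdl (- h) ltac:(lra) A').
  rewrite Rplus_0_l in B, B'.
  assert (M : phi h <= phi 0) by (apply Hmax; rewrite Rabs_pos_eq; lra).
  assert (M' : phi (- h) <= phi 0) by (apply Hmax; rewrite Rabs_Ropp, Rabs_pos_eq; lra).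
  set (q := (phi h - phi 0) / h) in B. set (q' := (phi (- h) - phi 0) / - h) in B'.
  assert (Q : q <= 0).
  { apply Rmult_le_reg_r with h; [exact Hh|]. unfold q.
    replace ((phi h - phi 0) / h * h) with (phi h - phi 0) by (field; lra). lra. }
  assert (Q' : 0 <= q').
  { apply Rmult_le_reg_r with h; [exact Hh|]. unfold q'.
    replace ((phi (- h) - phi 0) / - h * h) with (phi 0 - phi (- h)) by (field; lra). lra. }
  revert B B'. split_Rabs; lra. }
apply is_derive_Reals in H2. destruct (H2 (d / 2)) as [dl Hdl]; [lra|].
assert (K := cond_pos dl).
pose (h := Rmin (dl / 2) (d0 / 2)).
assert (Hh : 0 < h) by (apply Rmin_glb_lt; lra).
assert (Hh1 : h <= dl / 2) by apply Rmin_l. assert (Hh2 : h <= d0 / 2) by apply Rmin_r.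
destruct (MVT_cor2 phi phi1 0 h Hh) as (c & E & Hc).
- intros x Hx. apply is_derive_Reals, H1. rewrite Rabs_pos_eq; lra.
- assert (M : phi h <= phi 0) by (apply Hmax; rewrite Rabs_pos_eq; lra).
  assert (B := Hdl c ltac:(lra) ltac:(rewrite Rabs_pos_eq; lra)).
  rewrite Rplus_0_l, Z, Rminus_0_r in B. apply Rabs_def2 in B.
  assert (P : 0 < phi1 c).
  { replace (phi1 c) with (phi1 c / c * c) by (field; lra). apply Rmult_lt_0_compat; lra. }
  rewrite Rminus_0_r in E. nra.
Qed.

Lemma first_derivative_test (phi : R -> R) (tau d : R) :
  0 < tau -> is_derive phi 0 d ->
  (forall t, 0 <= t <= tau -> phi t <= phi 0) ->
  d <= 0.
Proof.
intros Ht H Hmax.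
destruct (Rle_or_lt d 0) as [|Hd]; [assumption|exfalso].
apply is_derive_Reals in H. destruct (H d Hd) as [dl Hdl].
assert (K := cond_pos dl).
pose (h := Rmin (dl / 2) tau).
assert (Hh : 0 < h) by (apply Rmin_glb_lt; lra).
assert (Hh1 : h <= dl / 2) by apply Rmin_l. assert (Hh2 : h <= tau) by apply Rmin_r.
assert (B := Hdl h ltac:(lra) ltac:(rewrite Rabs_pos_eq; lra)).
rewrite Rplus_0_l in B. apply Rabs_def2 in B.
assert (M := Hmax h ltac:(lra)).
set (q := (phi h - phi 0) / h) in B.
assert (E : phi h - phi 0 = q * h) by (unfold q; field; lra). nra.
Qed.

(** The second derivatives of |f|^2 + e |z|^2 in the directions 1 and i at z0 add up
    to its Laplacian 4 |f'(z0)|^2 + 4 e > 0, whereas both would be nonpositive at a local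
    maximum. The terms with f'' cancel because i^2 = -1. *)
Lemma no_interior_max (f f1 f2 : C -> C) (r e : R) (z0 : C) :
  0 < e -> r < 1 -> Cmod z0 < r ->
  (forall z, unit_disk z -> is_cderive f z (f1 z)) ->
  (forall z, unit_disk z -> is_cderive f1 z (f2 z)) ->
  (forall z, Cmod z <= r -> Cmod (f z) ^ 2 + e * Cmod z ^ 2 <= Cmod (f z0) ^ 2 + e * Cmod z0 ^ 2) ->
  False.
Proof.
intros He Hr Hz0 H1 H2 Hmax.
assert (D : forall zeta, Cmod zeta = 1 ->
  2 * (Cmod (f1 z0) ^ 2 + Re (Cconj (f z0) * f2 z0 * (zeta * zeta))%C + e) <= 0).
{ intros zeta Hzeta.
  pose (l t := (z0 + RtoC t * zeta)%C).
  assert (Hl : forall t, Rabs t < r - Cmod z0 -> Cmod (l t) < r).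
  { intros t Ht. unfold l. eapply Rle_lt_trans; [apply Cmod_triangle|].
    rewrite Cmod_mult, Cmod_R, Hzeta. lra. }
  pose (X t := Re (f (l t))). pose (Y t := Im (f (l t))).
  pose (X1 t := Re (zeta * f1 (l t))%C). pose (Y1 t := Im (zeta * f1 (l t))%C).
  pose (a := Re z0). pose (b := Im z0). pose (p := Re zeta). pose (q := Im zeta).
  pose (phi t := X t ^ 2 + Y t ^ 2 + e * ((a + t * p) ^ 2 + (b + t * q) ^ 2)).
  pose (phi1 t := 2 * X t * X1 t + 2 * Y t * Y1 t
                  + e * (2 * p * (a + t * p) + 2 * q * (b + t * q))).
  assert (DX : forall t, Rabs t < r - Cmod z0 -> is_derive X t (X1 t) /\ is_derive Y t (Y1 t)).
  { intros t Ht. apply is_cderive_line. apply H1. specialize (Hl t Ht). unfold unit_disk.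
    fold (l t). lra. }
  assert (L0 : l 0 = z0) by (unfold l; ring).
  assert (P0 : Rabs 0 < r - Cmod z0) by (rewrite Rabs_R0; lra).
  assert (DX1 : is_derive X1 0 (Re (zeta * (zeta * f2 z0))%C) /\
                is_derive Y1 0 (Im (zeta * (zeta * f2 z0))%C)).
  { apply (is_cderive_line (fun z => zeta * f1 z)%C z0 (zeta * f2 z0)%C).
    fold (l 0). rewrite L0.
    replace (zeta * f2 z0)%C with (0 * f1 z0 + zeta * f2 z0)%C by ring.
    apply (is_cderive_mult (fun _ => zeta)); [apply is_cderive_const|].
    apply H2. unfold unit_disk. lra. }
  assert (T : is_derive phi1 0 (2 * (X1 0 ^ 2 + X 0 * Re (zeta * (zeta * f2 z0))%C)
     + 2 * (Y1 0 ^ 2 + Y 0 * Im (zeta * (zeta * f2 z0))%C)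
     + e * (2 * p ^ 2 + 2 * q ^ 2))).
  { destruct (DX 0 P0) as [D1 D2]. destruct DX1 as [D3 D4]. unfold phi1.
    auto_derive.
    - repeat split; eexists; eassumption.
    - change (fun x => X x) with X. change (fun x => Y x) with Y.
      change (fun x => X1 x) with X1. change (fun x => Y1 x) with Y1.
      rewrite (is_derive_unique _ _ _ D1), (is_derive_unique _ _ _ D2),
        (is_derive_unique _ _ _ D3), (is_derive_unique _ _ _ D4). ring. }
  assert (Hpq : p ^ 2 + q ^ 2 = 1) by (unfold p, q; rewrite <- Cmod2_alt, Hzeta; ring).
  assert (Q : forall t, phi t = Cmod (f (l t)) ^ 2 + e * Cmod (l t) ^ 2).
  { intros t. rewrite !Cmod2_alt. unfold phi, X, Y, a, b, p, q.
    replace (Re (l t)) with (Re z0 + t * Re zeta) by (unfold l, Re; simpl; ring).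
    replace (Im (l t)) with (Im z0 + t * Im zeta) by (unfold l, Im; simpl; ring). ring. }
  assert (DP : forall t, Rabs t < r - Cmod z0 -> is_derive phi t (phi1 t)).
  { intros t Ht. destruct (DX t Ht) as [D1 D2]. unfold phi, phi1.
    auto_derive.
    - repeat split; eexists; eassumption.
    - change (fun x => X x) with X. change (fun x => Y x) with Y.
      rewrite (is_derive_unique _ _ _ D1), (is_derive_unique _ _ _ D2). ring. }
  assert (W := second_derivative_test phi phi1 (r - Cmod z0) _ ltac:(lra) DP T).
  replace (2 * _) with (2 * (X1 0 ^ 2 + X 0 * Re (zeta * (zeta * f2 z0))%C)
     + 2 * (Y1 0 ^ 2 + Y 0 * Im (zeta * (zeta * f2 z0))%C)
     + e * (2 * p ^ 2 + 2 * q ^ 2)).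
  - apply W. intros t Ht. rewrite !Q, L0. apply Hmax. apply Rlt_le, Hl, Ht.
  - assert (N : Cmod (f1 z0) ^ 2 = X1 0 ^ 2 + Y1 0 ^ 2).
    { unfold X1, Y1. rewrite L0, <- Cmod2_alt, Cmod_mult, Hzeta. ring. }
    assert (E : Re (Cconj (f z0) * f2 z0 * (zeta * zeta))%C
      = X 0 * Re (zeta * (zeta * f2 z0))%C + Y 0 * Im (zeta * (zeta * f2 z0))%C).
    { unfold X, Y. rewrite L0.
      replace (Cconj (f z0) * f2 z0 * (zeta * zeta))%C
        with (Cconj (f z0) * (zeta * (zeta * f2 z0)))%C by ring.
      rewrite re_mult, re_conj, im_conj. ring. }
    rewrite N, E. transitivity (2 * (X1 0 ^ 2 + X 0 * Re (zeta * (zeta * f2 z0))%C)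
     + 2 * (Y1 0 ^ 2 + Y 0 * Im (zeta * (zeta * f2 z0))%C)
     + 2 * e * (p ^ 2 + q ^ 2)); [ring|]. rewrite Hpq. ring. }
assert (A := D (RtoC 1) Cmod_1). assert (B := D Ci Cmod_Ci).
replace (Ci * Ci)%C with (RtoC (-1)) in B
  by (unfold Ci, RtoC, Cmult; simpl; f_equal; ring).
rewrite !Cmult_1_r in A. rewrite re_scal_r in B.
assert (K : 0 <= Cmod (f1 z0) ^ 2) by apply pow2_ge_0. lra.
Qed.

(** For every e > 0 the maximum of |f|^2 + e |z|^2 lies on the circle, where the
    perturbation is the constant e r^2; hence |f|^2 on the disk exceeds its maximum on the
    circle by at most e. *)
Lemma max_modulus (f f1 f2 : C -> C) (r : R) :
  0 < r < 1 ->
  (forall z, unit_disk z -> is_cderive f z (f1 z)) ->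
  (forall z, unit_disk z -> is_cderive f1 z (f2 z)) ->
  exists z0, Cmod z0 = r /\ forall z, Cmod z <= r -> Cmod (f z) <= Cmod (f z0).
Proof.
intros Hr H1 H2.
pose (u := fun e z => (Re (f z) ^ 2 + Im (f z) ^ 2) + e * (Re z ^ 2 + Im z ^ 2)).
assert (Hu : forall e z, Cmod z <= r ->
  continuity_2d_pt (fun x y => u e (x, y)) (Re z) (Im z)).
{ intros e z Hz.
  destruct (is_cderive_continuity_2d f z (f1 z)) as [Cr Ci].
  { apply H1. unfold unit_disk. lra. }
  unfold u. simpl Re. simpl Im.
  assert (S : forall g x y, continuity_2d_pt g x y -> continuity_2d_pt (fun x y => g x y ^ 2) x y).
  { intros g x y Hg. simpl. apply continuity_2d_pt_mult; [exact Hg|].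
    apply continuity_2d_pt_mult; [exact Hg | apply continuity_2d_pt_const]. }
  apply continuity_2d_pt_plus.
  - apply continuity_2d_pt_plus; apply S; [exact Cr | exact Ci].
  - apply continuity_2d_pt_mult; [apply continuity_2d_pt_const|].
    apply continuity_2d_pt_plus.
    + apply (S (fun x y => x)), continuity_2d_pt_id1.
    + apply (S (fun x y => y)), continuity_2d_pt_id2. }
assert (Hu0 : forall z, u 0 z = Cmod (f z) ^ 2) by (intros z; unfold u; rewrite Cmod2_alt; ring).
destruct (circle_max (u 0) r) as (z0 & Hz0 & Hmax); [lra | intros; now apply Hu |].
exists z0; split; [exact Hz0|]. intros z Hz.
apply Rsqr_incr_0_var; [|apply Cmod_ge_0]. rewrite !Rsqr_pow2.
rewrite <- !Hu0. apply le_epsilon. intros e He.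
destruct (disk_max (u e) r) as (ze & Hze & Hme); [lra | intros; now apply Hu |].
assert (Hue : forall w, u e w = Cmod (f w) ^ 2 + e * Cmod w ^ 2)
  by (intros w; unfold u; now rewrite !Cmod2_alt).
destruct (Rle_lt_or_eq_dec _ _ Hze) as [Hlt|Heq].
- exfalso. apply (no_interior_max f f1 f2 r e ze); trivial; [lra|].
  intros w Hw. rewrite <- !Hue. now apply Hme.
- specialize (Hme z Hz). rewrite !Hue, Heq in Hme. specialize (Hmax ze Heq).
  rewrite !Hu0 in *. assert (0 <= Cmod z ^ 2) by apply pow2_ge_0.
  assert (r ^ 2 <= 1) by nra. nra.
Qed.

(** Put W = z0 l conj(f(z0)). For every real lam the segment
    z0 (1 + t (-1 + i lam)) lies in the disk for small t >= 0, and half of the derivative of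
    |f|^2 along it at t = 0 is Re ((-1 + i lam) W) = - Re W - lam Im W. This is <= 0 for
    all lam only if Im W = 0 and Re W >= 0. *)
Lemma boundary_max_derivative (f : C -> C) (z0 l : C) :
  is_cderive f z0 l ->
  (forall z, Cmod z <= Cmod z0 -> Cmod (f z) <= Cmod (f z0)) ->
  Im (z0 * l * Cconj (f z0))%C = 0 /\ 0 <= Re (z0 * l * Cconj (f z0))%C.
Proof.
intros H Hmax. set (W := (z0 * l * Cconj (f z0))%C).
assert (D : forall lam, - Re W - lam * Im W <= 0).
{ intros lam. pose (zeta := (z0 * (-1, lam))%C).
  pose (X t := Re (f (z0 + RtoC t * zeta)%C)). pose (Y t := Im (f (z0 + RtoC t * zeta)%C)).
  assert (L0 : (z0 + RtoC 0 * zeta)%C = z0) by ring.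
  destruct (is_cderive_line f z0 l zeta 0) as [D1 D2]; [now rewrite L0|].
  fold X in D1. fold Y in D2.
  assert (T : is_derive (fun t => X t ^ 2 + Y t ^ 2) 0
    (2 * (X 0 * Re (zeta * l)%C + Y 0 * Im (zeta * l)%C))).
  { auto_derive; [repeat split; eexists; eassumption|].
    change (fun x => X x) with X. change (fun x => Y x) with Y.
    rewrite (is_derive_unique _ _ _ D1), (is_derive_unique _ _ _ D2). ring. }
  replace (- Re W - lam * Im W) with (X 0 * Re (zeta * l)%C + Y 0 * Im (zeta * l)%C).
  2:{ transitivity (Re (Cconj (f z0) * (zeta * l))%C).
      - rewrite (re_mult (Cconj _)), re_conj, im_conj. unfold X, Y. rewrite L0. ring.
      - transitivity (Re (W * (-1, lam))%C); [f_equal; unfold W, zeta; ring|].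
        rewrite re_mult. simpl. ring. }
  (* |1 + t (-1 + i lam)|^2 = 1 - 2 t + t^2 (1 + lam^2) is at most 1 for such t. *)
  assert (F := first_derivative_test _ (/ (1 + lam ^ 2)) _
    ltac:(apply Rinv_0_lt_compat; nra) T).
  cbv beta in F. cut (2 * (X 0 * Re (zeta * l)%C + Y 0 * Im (zeta * l)%C) <= 0); [lra|].
  apply F. intros t Ht. unfold X, Y. rewrite L0, <- !Cmod2_alt.
  apply pow_incr. split; [apply Cmod_ge_0|]. apply Hmax.
  replace (z0 + RtoC t * zeta)%C with (z0 * ((1 - t)%R, (lam * t)%R))%C
    by (unfold zeta; destruct z0; unfold RtoC, Cmult, Cplus; simpl; f_equal; ring).
  rewrite Cmod_mult. rewrite <- (Rmult_1_r (Cmod z0)) at 2.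
  apply Rmult_le_compat_l; [apply Cmod_ge_0|].
  unfold Cmod; cbv [fst snd]. apply Rle_trans with (sqrt 1); [apply sqrt_le_1_alt | rewrite sqrt_1; lra].
  assert (Hl : t * (1 + lam ^ 2) <= 1).
  { apply Rle_trans with (/ (1 + lam ^ 2) * (1 + lam ^ 2)).
    - apply Rmult_le_compat_r; [nra | lra].
    - rewrite Rinv_l; nra. }
  assert (Ht2 : t * (t * (1 + lam ^ 2)) <= t * 1) by (apply Rmult_le_compat_l; lra).
  nra. }
split.
- destruct (Req_dec (Im W) 0) as [|E]; [assumption|exfalso].
  (* With this slope - Re W - lam * Im W is at least 1. *)
  specialize (D (- (1 + Rabs (Re W)) / Im W)).
  replace (- Re W - - (1 + Rabs (Re W)) / Im W * Im W) with (- Re W + 1 + Rabs (Re W)) in D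
    by (field; exact E).
  assert (K := Rle_abs (Re W)). lra.
- specialize (D 0). lra.
Qed.

(** After multiplication by conj(Q) the claim compares b |Q|^2 with the sum of b |Q|^2
    and a nonnegative real number; since Re b > 0, the addition increases the real part in
    absolute value and leaves the imaginary part unchanged. *)
Lemma Cmod_add_same_direction (b Q d : C) :
  0 < Re b -> Im (d * Cconj Q)%C = 0 -> 0 <= Re (d * Cconj Q)%C ->
  Cmod b * Cmod Q <= Cmod (b * Q + d)%C.
Proof.
intros Hb HI HR.
assert (Q0 := Cmod_ge_0 Q). assert (T0 := Cmod_ge_0 (b * Q + d)).
destruct (Req_dec (Cmod Q) 0) as [E|E]; [rewrite E; lra|].
apply Rmult_le_reg_r with (Cmod Q); [lra|].
replace (Cmod (b * Q + d) * Cmod Q) with (Cmod ((b * Q + d) * Cconj Q)%C)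
  by now rewrite Cmod_mult, Cmod_conj.
replace ((b * Q + d) * Cconj Q)%C with (b * RtoC (Cmod Q ^ 2) + d * Cconj Q)%C
  by (rewrite Cmod2_conj; ring).
set (W := (d * Cconj Q)%C) in *. set (m := Cmod Q) in *.
apply Rsqr_incr_0_var; [|apply Cmod_ge_0]. rewrite !Rsqr_pow2.
replace ((Cmod b * m * m) ^ 2) with (Cmod b ^ 2 * (m ^ 2) ^ 2) by ring.
rewrite !Cmod2_alt.
replace (Re (b * RtoC (m ^ 2) + W)%C) with (Re b * m ^ 2 + Re W)
  by (rewrite re_plus, re_scal_r; ring).
replace (Im (b * RtoC (m ^ 2) + W)%C) with (Im b * m ^ 2 + Im W)
  by (unfold Im; simpl; ring).
rewrite HI. assert (0 <= Re b * m ^ 2) by (apply Rmult_le_pos; [lra | apply pow2_ge_0]).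
nra.
Qed.

Theorem theorem2 (n : nat) (f : C -> C) (alpha : R) (beta : C)
  (hn : (1 <= n)%nat)
  (hf : class_A n f)
  (halpha : 0 <= alpha < 1)
  (hbeta : Re beta < INR n)
  (hineq : forall z : C, unit_disk z ->
     Cmod (z * C_derive (C_derive f) z - beta * (C_derive f z - RtoC 1))%C
       < (1 - alpha) * Cmod (RtoC (INR n) - beta)%C) :
  (forall z : C, unit_disk z -> Cmod (C_derive f z - RtoC 1)%C < 1 - alpha) /\
  class_C n alpha f.
Proof.
pose proof hf as [hf1 (a & _ & ha1 & ha & hs)].
assert (hA : forall z, unit_disk z -> exists l, is_cpseries a z l)
  by (intros z Hz; exists (f z); now apply hs).
pose (q := fun k => CPS_derive a (n + k)%nat).
pose (Q := CPSeries q).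
assert (hC : forall z, unit_disk z ->
  is_cpseries q z (Q z) /\ C_derive f z = (1 + z ^ n * Q z)%C).
{ intros z Hz. destruct (CPSeries_derive a hA z Hz) as [hc hd].
  destruct (CPSeries_factor (CPS_derive a) n z
    (CPSeries (CPS_derive a) z) hn) with (2 := CPSeries_correct _ _ hc)
    as [h1 h2].
  - intros k Hk. unfold CPS_derive. rewrite ha by lia. ring.
  - split; [exact h1|]. fold q Q in h2.
    unfold CPS_derive at 2 in h2. rewrite ha1 in h2. simpl INR in h2.
    rewrite (is_C_derive_unique f z (CPSeries (CPS_derive a) z)).
    + rewrite <- h2. ring.
    + apply (is_cderive_ext_disk (CPSeries a)); trivial.
      intros w Hw. apply CPSeries_unique. now apply hs. }
assert (hq : forall z, unit_disk z -> exists l, is_cpseries q z l)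
  by (intros z Hz; exists (Q z); now apply hC).
pose (Q1 := CPSeries (CPS_derive q)). pose (Q2 := CPSeries (CPS_derive (CPS_derive q))).
assert (hQ1 : forall z, unit_disk z -> is_cderive Q z (Q1 z))
  by (intros z Hz; now apply CPSeries_derive).
assert (hQ2 : forall z, unit_disk z -> is_cderive Q1 z (Q2 z)).
{ intros z Hz; apply CPSeries_derive; [|exact Hz].
  intros w Hw. now apply CPSeries_derive. }
assert (hg : forall z, unit_disk z ->
  (z * C_derive (C_derive f) z - beta * (C_derive f z - RtoC 1))%C
  = (z ^ n * ((RtoC (INR n) - beta) * Q z + z * Q1 z))%C).
{ intros z Hz.
  assert (D := is_cderive_mult _ _ _ _ _ (is_cderive_pow n z) (hQ1 z Hz)).
  rewrite (is_C_derive_unique (C_derive f) z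
    (RtoC (INR n) * z ^ pred n * Q z + z ^ n * Q1 z)%C).
  - rewrite (proj2 (hC z Hz)). destruct n as [|m]; [lia|]. simpl Nat.pred.
    change (z ^ S m)%C with (z * z ^ m)%C. ring.
  - apply (is_cderive_ext_disk (fun w => 1 + w ^ n * Q w)%C).
    + intros w Hw. symmetry. now apply hC.
    + exact Hz.
    + rewrite <- (Cplus_0_l (_ + _)%C).
      exact (is_derive_plus (K := C_AbsRing) (V := C_NormedModule) _ _ _ _ _
        (is_cderive_const 1%C z) D). }
assert (main : forall z : C, unit_disk z -> Cmod (C_derive f z - RtoC 1)%C < 1 - alpha).
{ intros z Hz. rewrite (proj2 (hC z Hz)).
  replace (1 + z ^ n * Q z - 1)%C with (z ^ n * Q z)%C by ring.
  rewrite Cmod_mult, Cmod_pow. unfold unit_disk in Hz.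
  destruct (Rle_lt_or_eq_dec _ _ (Cmod_ge_0 z)) as [Hr|Hr].
  2:{ rewrite <- Hr, pow_i by lia. lra. }
  destruct (max_modulus Q Q1 Q2 (Cmod z) (conj Hr Hz) hQ1 hQ2) as (z0 & Hz0 & Hmax).
  assert (Hz0d : unit_disk z0) by (unfold unit_disk; lra).
  destruct (boundary_max_derivative Q z0 (Q1 z0) (hQ1 z0 Hz0d)) as [HI HR].
  { intros w Hw. apply Hmax. lra. }
  assert (Hb : 0 < Re (RtoC (INR n) - beta)%C)
    by (unfold Cminus; rewrite re_plus, re_opp, re_RtoC; lra).
  assert (K := Cmod_add_same_direction _ (Q z0) (z0 * Q1 z0)%C Hb HI HR).
  specialize (hineq z0 Hz0d). rewrite hg, Cmod_mult, Cmod_pow, Hz0 in hineq by exact Hz0d.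
  specialize (Hmax z (Rle_refl _)).
  assert (Hp : 0 < Cmod z ^ n) by now apply pow_lt.
  assert (B0 : 0 < Cmod (RtoC (INR n) - beta)%C).
  { eapply Rlt_le_trans; [exact Hb|]. eapply Rle_trans; [apply Rle_abs | apply re_le_Cmod]. }
  apply Rmult_lt_reg_r with (Cmod (RtoC (INR n) - beta)%C); [exact B0|].
  eapply Rle_lt_trans; [|exact hineq]. rewrite Rmult_assoc.
  apply Rmult_le_compat_l; [lra|].
  eapply Rle_trans; [|exact K]. rewrite Rmult_comm. apply Rmult_le_compat_l; lra. }
split; [exact main|]. split; [exact hf|].
intros z Hz. specialize (main z Hz).
assert (E := Rle_lt_trans _ _ _ (re_le_Cmod _) main).
unfold Cminus in E. rewrite re_plus, re_opp, re_RtoC in E. apply Rabs_def2 in E. lra.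
Qed.
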